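(* Let $G$ be a finite graph with $n = |V(G)| \geq 1$ vertices. Then there is a graph $G'$ containing $G$ as an induced subgraph such that $G'$ is simple and $|V(G')| - |V(G)| \leq \lceil \log_2(n+1) \rceil$.
   Context: Graphs are finite, undirected, without loops or multiple edges. An interval of a graph $H$ is a set $I \subseteq V(H)$ such that $N(u)\setminus I = N(v)\setminus I$ for all $u,v \in I$, where $N(u)$ is the neighbourhood of $u$. The empty set, all singletons and $V(H)$ are intervals; any other interval is proper. A graph is simple if it has no proper intervals. *)

(* Defs.v *)
From mathcomp Require Import all_boot.
Set Implicit Arguments.
Unset Strict Implicit.
Unset Printing Implicit Defensive.

Record graph := Graph {
  vertex :> finType;
  adj : rel vertex;
  adj_sym : symmetric adj;
  adj_irrefl : irreflexive adj }.

Section Intervals.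
Variable G : graph.
Implicit Types (u v : G) (I : {set G}).

Definition neighbourhood u : {set G} := [set v | adj u v].

Definition interval I : bool :=
  [forall u in I, forall v in I,
     neighbourhood u :\: I == neighbourhood v :\: I].

Definition proper_interval I : bool :=
  [&& interval I, I != set0, ~~ [exists u, I == [set u]] & I != setT].

Definition simple_graph : bool := ~~ [exists I, proper_interval I].

End Intervals.

(* An isomorphism of G onto the subgraph of G' induced by the image of f. *)
Definition induced_embedding (G G' : graph) (f : G -> G') : Prop :=
  injective f /\ forall u v : G, adj (f u) (f v) = adj u v.

Definition contains_induced (G' G : graph) : Prop :=
  exists f : G -> G', induced_embedding f.

(* Main.v *)
Require Import Defs.
From mathcomp Require Import all_boot.
From mathcomp Require Import perm.
Set Implicit Arguments.
Unset Strict Implicit.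
Unset Printing Implicit Defensive.

(** Add an independent set [W] of [k] new vertices and join each [v] to a subset
    [S v] of [W], where [S] is injective, avoids [W] itself and, for [k >= 3],
    takes every two-element set as a value.  Injectivity separates the old
    vertices and the two-element labels separate [W], so the only dangerous
    intervals consist of one new vertex [a] and old vertices labelled by [set0]
    or [set a]; then such an old vertex has the same neighbours as [a] among the
    vertices labelled by pairs.  A vertex can mimic at most one [a] in this way,
    and a vertex that mimics some [a] in [G] mimics none in the complement of
    [G].  Since complementation preserves intervals, one may work in whichever
    of the two graphs has enough harmless vertices, and then permute the
    remaining labels until no vertex mimics the element of its own label. *)

(** * Intervals, simplicity and complements *)

Lemma intervalP (G : graph) (I : {set G}) :
  reflect {in I &, forall u v w, w \notin I -> adj u w = adj v w} (interval I).
Proof.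
apply: (iffP forall_inP) => [iI u v uI vI w wI | iI u uI].
  have /forall_inP/(_ v vI)/eqP/setP/(_ w) := iI u uI.
  by rewrite !inE wI.
apply/forall_inP => v vI; apply/eqP/setP => w; rewrite !inE.
by case: (boolP (w \in I)) => //= wI; apply: iI.
Qed.

Lemma simple_graphI (G : graph) :
  (forall I : {set G}, interval I ->
     [\/ I = set0, exists u, I = [set u] | I = setT]) ->
  simple_graph G.
Proof.
move=> trivG; apply/existsPn => I; apply/and4P => -[iI /eqP I0 /existsPn I1 /eqP IT].
by case: (trivG I iI) => // -[u Iu]; case/eqP: (I1 u).
Qed.

Section Complement.
Variable G : graph.

Definition co_adj : rel G := fun u v => (u != v) && ~~ adj u v.

Lemma co_adj_sym : symmetric co_adj.
Proof. by move=> u v; rewrite /co_adj eq_sym adj_sym. Qed.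

Lemma co_adj_irrefl : irreflexive co_adj.
Proof. by move=> u; rewrite /co_adj eqxx. Qed.

Definition compl_graph := Graph co_adj_sym co_adj_irrefl.

End Complement.

Lemma compl_interval (G : graph) (I : {set G}) :
  interval (I : {set compl_graph G}) = interval I.
Proof.
apply/intervalP/intervalP => iI u v uI vI w wI; have := iI u v uI vI w wI;
  rewrite /= /co_adj.
  have [/negPf-> /negPf->] : u != w /\ v != w.
    by split; apply: contraNneq wI => <-.
  by move/negb_inj.
by move=> ->; congr (~~ _ && _); apply/eqP/eqP => e; case/negP: wI; rewrite -e.
Qed.

Lemma compl_simple (G : graph) : simple_graph (compl_graph G) = simple_graph G.
Proof.
by congr (~~ _); apply: eq_existsb => I; rewrite /proper_interval compl_interval.
Qed.

Definition simple_extension_by (G : graph) (k : nat) :=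
  exists G' : graph,
    [/\ contains_induced G' G, simple_graph G' & #|G'| = #|G| + k].

Lemma simple_extension_compl (G : graph) k :
  simple_extension_by (compl_graph G) k -> simple_extension_by G k.
Proof.
case=> G' [[f [injf adjf]] sG' cG']; exists (compl_graph G').
split; rewrite ?compl_simple //; exists f; split=> // u v.
rewrite /= /co_adj adjf /= /co_adj (inj_eq injf).
by case: eqP => [->|] //=; rewrite ?adj_irrefl ?negbK.
Qed.

(** * Joining a graph to an independent set through labels *)

Section Extension.
Variables (G : graph) (W : finType) (S : G -> {set W}).

Definition ext_adj (x y : G + W) : bool :=
  match x, y with
  | inl u, inl v => adj u v
  | inl u, inr a => a \in S u
  | inr a, inl u => a \in S u
  | inr _, inr _ => false
  end.

Lemma ext_adj_sym : symmetric ext_adj.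
Proof. by case=> u [] v //=; apply: adj_sym. Qed.

Lemma ext_adj_irrefl : irreflexive ext_adj.
Proof. by case=> u //=; apply: adj_irrefl. Qed.

Definition ext_graph := Graph ext_adj_sym ext_adj_irrefl.

Lemma ext_graph_contains : contains_induced ext_graph G.
Proof. by exists inl; split=> // u v []. Qed.

(** Intervals that miss all new vertices or contain all of them are settled here; those that cut [W]
    are left to the last hypothesis, since excluding them depends on the labelling. *)
Lemma ext_graph_simple :
  0 < #|W| -> injective S -> (forall v, S v != setT) ->
  (forall v, S v = set0 -> exists x, adj v x) ->
  (forall (I : {set ext_graph}) a b, interval I ->
     inr a \in I -> inr b \notin I -> I = [set inr a]) ->
  simple_graph ext_graph.
Proof.
move=> /card_gt0P[a0 _] injS ST S0 cutW; apply: simple_graphI => I iI.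
move/intervalP: (iI) => sepI.
have [/existsP[a aI] | /existsPn noW] := boolP [exists a, inr a \in I]; last first.
  have [->|/set0Pn[[u|a] uI]] := eqVneq I set0; first by constructor 1.
    2: by have := noW a; rewrite uI.
  constructor 2; exists (inl u); apply/setP => -[v|a]; rewrite !inE.
    2: by rewrite (negPf (noW a)).
  apply/idP/eqP => [vI|-> //]; congr inl; apply: injS; apply/setP => a.
  exact: (sepI _ _ vI uI (inr a) (noW a)).
have [/existsP[b bI] | /existsPn allW] := boolP [exists b, inr b \notin I].
  by constructor 2; exists (inr a); apply: cutW bI.
have {}allW b : inr b \in I by have := allW b; rewrite negbK.
(* A vertex outside [I] sees all new vertices or none of them, and its label is not [setT]. *)
have out v : inl v \notin I -> S v = set0.
  move=> vI; apply/setP => b; rewrite inE; apply/negbTE/negP => bv.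
  case/eqP: (ST v); apply/setP => c; rewrite inE -bv.
  exact: (sepI _ _ (allW c) (allW b) (inl v) vI).
constructor 3; apply/setP => -[v|b]; rewrite in_setT ?allW //.
(* The neighbour [x] cannot lie in [I], since [a] does not see [v]; outside [I] its label is also
   empty, so [x = v]. *)
apply: contraT => vI; have [x vx] := S0 v (out v vI).
have [xI|xI] := boolP (inl x \in I).
  have := sepI _ _ xI aI (inl v) vI.
  by rewrite /= out // inE adj_sym vx.
by move: vx; rewrite (injS x v) ?adj_irrefl // !out.
Qed.

(* Forced when [v] and the new vertex [a] lie in a common proper interval, since
   such an interval contains no vertex labelled by a pair. *)
Definition mimics v a : bool :=
  [forall r, (#|S r| == 2) ==> (adj v r == (a \in S r))].

Definition mimic v : bool := [exists a, mimics v a].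

End Extension.

Lemma mimicsP (G : graph) (W : finType) (S : G -> {set W}) v a :
  reflect (forall r, #|S r| = 2 -> adj v r = (a \in S r)) (mimics S v a).
Proof.
apply: (iffP forallP) => H r; last by apply/implyP => /eqP/H->.
by move/eqP => Sr; have /implyP/(_ Sr)/eqP := H r.
Qed.

(** * Labellings that use every pair *)

Section Labelling.
Variables (G : graph) (W : finType) (S : G -> {set W}).
Hypothesis W3 : 2 < #|W|.
Hypothesis pairS : forall A : {set W}, #|A| = 2 -> exists v, S v = A.

Lemma other2 (a b : W) : exists c, (c != a) && (c != b).
Proof.
apply/existsP; apply: contraTT W3 => /existsPn H; rewrite -leqNgt.
rewrite (leq_trans _ (card_size [:: a; b])) // subset_leq_card //.
by apply/subsetP => c _; have := H c; rewrite negb_and !negbK !inE.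
Qed.

Lemma pair_label (a b : W) : a != b -> exists2 r, #|S r| = 2 & S r = [set a; b].
Proof.
move=> ab; have c2 : #|[set a; b]| = 2 by rewrite cards2 ab.
by have [r Sr] := pairS c2; exists r => //; rewrite Sr.
Qed.

(** A pair [[set a; c]] with [c] different from both [a] and [b] would force contradictory
    adjacencies. *)
Lemma mimics_inj v a b : mimics S v a -> mimics S v b -> a = b.
Proof.
move=> /mimicsP va /mimicsP vb; apply/eqP; apply: contraT => ab.
have [c /andP[ca cb]] := other2 a b.
have [|r r2 Sr] := @pair_label a c; first by rewrite eq_sym.
by have := va r r2; rewrite vb // Sr !inE eqxx eq_sym (negPf ab) eq_sym (negPf cb).
Qed.

(** If [v] mimics [a] in [G] and [b] in the complement, a vertex whose label is a pair containing
    both would be adjacent to [v] in both graphs. *)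
Lemma mimic_compl v :
  #|S v| != 2 -> mimic S v -> ~~ mimic (S : compl_graph G -> _) v.
Proof.
move=> v2 /existsP[a /mimicsP va]; apply/existsPn => b; apply/negP => /mimicsP vb.
have [c ca cb] : exists2 c, c != a & b \in [set a; c].
  have [<-|ba] := eqVneq b a.
    by have [c /andP[cb _]] := other2 b b; exists c; rewrite // !inE eqxx.
  by exists b; rewrite // !inE eqxx orbT.
have [|r r2 Sr] := @pair_label a c; first by rewrite eq_sym.
have := vb r r2; rewrite /= /co_adj va // Sr cb !inE eqxx /=.
by rewrite andbF.
Qed.

(** Supplies the neighbour that a vertex given the empty label must have in the complement: a pair
    avoiding [a] labels a non-neighbour of [v]. *)
Lemma mimic_compl_neighbour v :
  #|S v| != 2 -> mimic S v -> exists x : compl_graph G, adj (v : compl_graph G) x.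
Proof.
move=> v2 /existsP[a /mimicsP va].
have [b /andP[ba _]] := other2 a a; have [c /andP[ca cb]] := other2 a b.
have [|r r2 Sr] := @pair_label b c; first by rewrite eq_sym.
exists r; rewrite /= /co_adj va // Sr !inE !(eq_sym a) (negPf ba) (negPf ca) andbT.
by apply: contraNneq v2 => ->; rewrite r2.
Qed.

Lemma ext_graph_simple_of_labelling :
  injective S -> (forall v, S v != setT) ->
  (forall v, S v = set0 -> ~~ mimic S v /\ exists x, adj v x) ->
  (forall v a, S v = [set a] -> ~~ mimics S v a) ->
  simple_extension_by G #|W|.
Proof.
move=> injS ST S0 S1; exists (ext_graph S); split.
- exact: ext_graph_contains.
- apply: ext_graph_simple => //; first exact: leq_trans W3.
    by move=> v /S0[].
  move=> I a b /intervalP iI aI bI.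
  have inI v : inl v \in I -> forall c, inr c \notin I -> c \notin S v.
    by move=> vI c cI; have /= -> := iI _ _ vI aI (inr c) cI.
  (* The vertex [r] labelled [[set a; b]] is outside [I], as [b] sees it but not [a]. Since [a] sees
     [r], so does [c], which is thus [a] or [b]. *)
  have aW c : inr c \in I -> c = a.
    move=> cI; apply/eqP; apply: contraT => ca.
    have [|r r2 Sr] := @pair_label a b.
      by apply: contraNneq bI => <-.
    have rI : inl r \notin I.
      by apply/negP => /inI/(_ b bI); rewrite Sr !inE eqxx orbT.
    have := iI _ _ aI cI (inl r) rI.
    rewrite /= Sr !inE eqxx (negPf ca) /= => /esym/eqP cb.
    by rewrite -cb cI in bI.
  have Sub v : inl v \in I -> S v \subset [set a].
    move=> vI; apply/subsetP => c; rewrite inE; apply: contraLR => ca.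
    by apply: inI => //; apply: contra ca => /aW->.
  have mimI v : inl v \in I -> mimics S v a.
    move=> vI; apply/mimicsP => r r2; apply: (iI _ _ vI aI (inl r)).
    by apply/negP => /Sub/subset_leq_card; rewrite r2 cards1.
  apply/setP => -[v|c]; rewrite !inE.
    apply/negbTE/negP => vI; have := Sub v vI; rewrite subset1 => /orP[] /eqP Sv.
      by have := S1 _ _ Sv; rewrite mimI.
    by have [/existsPn/(_ a)] := S0 _ Sv; rewrite mimI.
  by apply/idP/eqP => [/aW->|[->]].
by rewrite card_sum.
Qed.

End Labelling.

(** * Choosing and permuting labels *)

(* A minimizer of the number of bad elements has none: exchanging a bad element
   with [x1] would repair it. *)
Lemma perm_avoid (T : finType) (L : eqType) (U : {set T}) (f : T -> L)
    (bad : T -> L -> bool) x1 :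
  injective f -> x1 \in U -> (forall l, ~~ bad x1 l) ->
  (forall x l l', bad x l -> bad x l' -> l = l') ->
  exists2 s : {perm T}, perm_on U s & forall x, x \in U -> ~~ bad x (f (s x)).
Proof.
move=> injf x1U good1 badU.
pose B (s : {perm T}) := [set x in U | bad x (f (s x))].
have [s sU smin] := arg_minnP (fun s => #|B s|) (perm_on1 U : perm_on U 1%g).
exists s => // x xU; apply/negP => xbad.
have xx1 : x != x1 by apply: contraTneq xbad => ->; apply: good1.
pose t := (tperm x x1 * s)%g.
have tU : perm_on U t.
  rewrite perm_onM //; apply/subsetP => y; rewrite !inE.
  by case: tpermP => [->|->|]; rewrite ?eqxx.
have := smin t tU; rewrite leqNgt => /negP[]; apply: proper_card.
apply/properP; split; last first.
  exists x; rewrite !inE xU //= permM tpermL; apply/negP => xbad'.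
  have /injf/perm_inj/eqP := badU _ _ _ xbad xbad'.
  by rewrite (negPf xx1).
apply/subsetP => y; rewrite !inE permM => /andP[yU].
case: tpermP => [->|->|_ _]; rewrite ?(negPf (good1 _)) //.
  by rewrite xU xbad.
by rewrite yU.
Qed.

(** [P] is padded with elements of [Q] up to the size of [T], and the result is matched with [T] by
    rank. *)
Lemma inj_between (T L : finType) (P Q : {set L}) :
  P \subset Q -> #|P| <= #|T| <= #|Q| ->
  exists f : T -> L, [/\ injective f, forall l, l \in P -> exists x, f x = l
                       & forall x, f x \in Q].
Proof.
move=> PQ /andP[PT TQ].
have : #|T| - #|P| <= #|Q :\: P|.
  by rewrite cardsD (setIidPr PQ) leq_sub2r.
case/card_geqP => s [us ss sQ].
pose B := P :|: [set x in s].
have cB : #|T| = #|B|.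
  rewrite cardsU disjoint_setI0 ?cards0 ?subn0; last first.
    rewrite disjoint_sym; apply/pred0P => y /=; apply/negbTE/andP => -[].
    by rewrite inE => /sQ; rewrite inE => /andP[/negPf->].
  by rewrite cardsE (card_uniqP us) ss subnKC.
exists (fun x => enum_val (cast_ord cB (enum_rank x))); split.
- by move=> x y /enum_val_inj/cast_ord_inj/enum_rank_inj.
- move=> l lP; have lB : l \in B by rewrite inE lP.
  exists (enum_val (cast_ord (esym cB) (enum_rank_in lB l))).
  by rewrite enum_valK cast_ordKV enum_rankK_in.
move=> x; have := enum_valP (cast_ord cB (enum_rank x)).
by rewrite !inE => /orP[/(subsetP PQ)|/sQ] //; rewrite inE => /andP[].
Qed.

(** Mimicry depends only on which vertices carry the pair labels, and [s] fixes these. *)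
Lemma mimics_perm (G : graph) (W : finType) (S : G -> {set W}) (s : {perm G}) :
  perm_on [set v | #|S v| != 2] s -> mimics (S \o s) =2 mimics S.
Proof.
move=> sU v a; apply: eq_forallb => r /=.
have [r2|r2] := boolP (r \in [set v | #|S v| != 2]).
  have := r2; rewrite -(perm_closed r sU) !inE => /negPf->.
  by move: r2; rewrite inE => /negPf->.
by rewrite (out_perm sU).
Qed.

Section Relabelling.
Variables (G : graph) (W : finType) (S : G -> {set W}).
Hypothesis W3 : 2 < #|W|.
Hypothesis injS : injective S.
Hypothesis ST : forall v, S v != setT.
Hypothesis pairS : forall A : {set W}, #|A| = 2 -> exists v, S v = A.

(** As [u] mimics nothing, no label is bad for it, and it can serve for the exchanges of
    [perm_avoid]. *)
Lemma simple_extension_of_free_vertex u :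
  #|S u| != 2 -> S u != set0 -> ~~ mimic S u ->
  (forall v, S v = set0 -> ~~ mimic S v /\ exists x, adj v x) ->
  simple_extension_by G #|W|.
Proof.
move=> u2 u0 uM S0.
(* Pair labels stay in place so that mimicry does not change, and the empty label so that [S0]
   survives. *)
pose U := [set v | (#|S v| != 2) && (S v != set0)].
pose bad v l := [exists a, (l == [set a]) && mimics S v a].
have [|l|v l l'|s sU sgood] := @perm_avoid _ _ U S bad u injS.
- by rewrite inE u2.
- by apply/existsPn => a; rewrite negb_and (existsPn uM) orbT.
- move=> /existsP[a /andP[/eqP-> va]] /existsP[b /andP[/eqP-> vb]].
  by rewrite (mimics_inj W3 pairS va vb).
have sU2 : perm_on [set v | #|S v| != 2] s.
  by apply: subset_trans sU _; apply/subsetP => v; rewrite !inE => /andP[].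
have mimE : mimics (S \o s) =2 mimics S by apply: mimics_perm.
apply: (@ext_graph_simple_of_labelling G W (S \o s)) => //.
- by move=> A /pairS[v <-]; exists ((s^-1)%g v); rewrite /= permKV.
- exact: inj_comp injS perm_inj.
- by move=> v; apply: ST.
- move=> v /= Sv.
  have vU : v \notin U by rewrite -(perm_closed v sU) inE Sv eqxx andbF.
  have [mv nv] := S0 v (etrans (congr1 S (esym (out_perm sU vU))) Sv).
  by split=> //; rewrite /mimic (eq_existsb (mimE v)).
move=> v a /= Sv; rewrite mimE; apply/negP => va.
have vU : v \in U.
  by rewrite -(perm_closed v sU) inE Sv cards1 /= -cards_eq0 cards1.
by have /existsPn/(_ a) := sgood v vU; rewrite Sv eqxx va.
Qed.

End Relabelling.

(** A swap gives the empty label to [u0], where it is harmless, and leaves [u1] as the free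
    vertex. *)
Lemma simple_extension_of_free_pair (G : graph) (W : finType) (S : G -> {set W}) :
  2 < #|W| -> injective S -> (forall v, S v != setT) ->
  (forall A : {set W}, #|A| = 2 -> exists v, S v = A) ->
  (exists z, S z = set0) ->
  forall u0 u1, u0 != u1 -> #|S u0| != 2 -> #|S u1| != 2 ->
  ~~ mimic S u0 -> ~~ mimic S u1 -> (exists x, adj u0 x) ->
  simple_extension_by G #|W|.
Proof.
move=> W3 injS ST pairS [z Sz] u0 u1 u01 u02 u12 m0 m1 nb0.
have sU : perm_on [set v | #|S v| != 2] (tperm u0 z).
  apply/subsetP => y; rewrite !inE.
  by case: tpermP => [-> _|-> _|_ _]; rewrite ?eqxx // Sz cards0.
have mimE v : mimic (S \o tperm u0 z) v = mimic S v.
  exact: eq_existsb (mimics_perm sU v).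
have injS' : injective (S \o tperm u0 z) := inj_comp injS perm_inj.
have S'0 : (S \o tperm u0 z) u0 = set0 by rewrite /= tpermL.
apply: (@simple_extension_of_free_vertex G W (S \o tperm u0 z) _ _ _ _ u1) => //.
- by move=> v; apply: ST.
- by move=> A /pairS[v <-]; exists (tperm u0 z v); rewrite /= tpermK.
- have : u1 \in [set v | #|S v| != 2] by rewrite inE.
  by rewrite -(perm_closed u1 sU) inE.
- by rewrite -S'0 (inj_eq injS') eq_sym.
- by rewrite mimE.
by move=> v; rewrite -S'0 => /injS'->; rewrite mimE.
Qed.

(** * Large graphs, with and without the empty label *)

Lemma compl_no_isolated (G : graph) :
  1 < #|G| -> ~~ [forall v : G, [exists x, adj v x]] ->
  [forall v : compl_graph G, [exists x, adj v x]].
Proof.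
move=> G2 /forallPn[z /existsPn z0]; apply/forallP => v; apply/existsP.
have [->|vz] := eqVneq v z.
  have [x xz] : exists x : G, x != z.
    apply/existsP; apply: contraTT G2 => /existsPn H; rewrite -leqNgt.
    rewrite (leq_trans _ (card_size [:: z])) // subset_leq_card //.
    by apply/subsetP => x _; rewrite inE -[_ == _]negbK.
  by exists x; rewrite /= /co_adj eq_sym xz z0.
by exists z; rewrite /= /co_adj vz adj_sym z0.
Qed.

(** Of three vertices labelled by [set0] and two singletons, two agree on whether they mimic
    anything in [G]. If neither does, they are a free pair in [G]; if both do, they are one in the
    complement. *)
Lemma simple_extension_no_isolated (G : graph) (W : finType) (S : G -> {set W}) :
  2 < #|W| -> injective S -> (forall v, S v != setT) ->
  (forall A, A != setT -> exists v, S v = A) ->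
  [forall v : G, [exists x, adj v x]] ->
  simple_extension_by G #|W|.
Proof.
move=> W3 injS ST surjS /forallP nb.
have small (A : {set W}) : #|A| <= 2 -> exists v, S v = A.
  by move=> A2; apply: surjS; apply: contraTneq A2 => ->; rewrite cardsT -ltnNge.
have pairS (A : {set W}) : #|A| = 2 -> exists v, S v = A.
  by move=> A2; apply: small; rewrite A2.
have zS : exists z, S z = set0 by apply: small; rewrite cards0.
have [a [b ab]] : exists a b : W, a != b.
  have /card_gt0P[a _] : 0 < #|W| by apply: leq_trans W3.
  by have [b /andP[ba _]] := other2 W3 a a; exists b, a.
have [[z Sz] [x Sx] [y Sy]] : [/\ exists z, S z = set0,
    exists x, S x = [set a] & exists y, S y = [set b]].
  by split; apply: small; rewrite ?cards0 ?cards1.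
have neqS v w : S v != S w -> v != w by apply: contraNneq => ->.
have zx : z != x by apply: neqS; rewrite Sz Sx eq_sym -cards_eq0 cards1.
have zy : z != y by apply: neqS; rewrite Sz Sy eq_sym -cards_eq0 cards1.
have xy : x != y by apply: neqS; rewrite Sx Sy (inj_eq set1_inj).
have z2 : #|S z| != 2 by rewrite Sz cards0.
have x2 : #|S x| != 2 by rewrite Sx cards1.
have y2 : #|S y| != 2 by rewrite Sy cards1.
have in_G u v : u != v -> #|S u| != 2 -> #|S v| != 2 ->
    ~~ mimic S u -> ~~ mimic S v -> simple_extension_by G #|W|.
  move=> uv u2 v2 um vm.
  by apply: (simple_extension_of_free_pair W3 injS ST pairS zS uv) => //; apply/existsP.
have in_compl u v : u != v -> #|S u| != 2 -> #|S v| != 2 ->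
    mimic S u -> mimic S v -> simple_extension_by G #|W|.
  move=> uv u2 v2 um vm; apply: simple_extension_compl.
  apply: (@simple_extension_of_free_pair (compl_graph G) W S W3 injS ST pairS zS u v uv u2 v2).
  - exact (mimic_compl W3 pairS u2 um).
  - exact (mimic_compl W3 pairS v2 vm).
  - exact (mimic_compl_neighbour W3 pairS u2 um).
have [zm|zm] := boolP (mimic S z); have [xm|xm] := boolP (mimic S x);
  have [ym|ym] := boolP (mimic S y);
  by [exact: in_G zx _ _ _ _ | exact: in_G zy _ _ _ _ | exact: in_G xy _ _ _ _
     |exact: in_compl zx _ _ _ _ | exact: in_compl zy _ _ _ _
     |exact: in_compl xy _ _ _ _].
Qed.

(** Either some vertex with a non-pair label is free, or all of these mimic in [G], hence none in
    the complement, where the labelling works unchanged. *)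
Lemma simple_extension_no_empty_label (G : graph) (W : finType) (S : G -> {set W}) :
  2 < #|W| -> injective S -> (forall v, S v != setT) -> (forall v, S v != set0) ->
  (forall A : {set W}, #|A| = 2 -> exists v, S v = A) ->
  simple_extension_by G #|W|.
Proof.
move=> W3 injS ST S0 pairS.
have no0 v : S v <> set0 by apply/eqP.
have [/existsP[u /andP[u2 um]]|/existsPn allm] :=
  boolP [exists u, (#|S u| != 2) && ~~ mimic S u].
  by apply: (@simple_extension_of_free_vertex G W S W3 injS ST pairS u) => // v /no0.
apply: simple_extension_compl.
apply: (@ext_graph_simple_of_labelling (compl_graph G) W S W3) => // [v /no0 //|v a Sv].
have v2 : #|S v| != 2 by rewrite Sv cards1.
have := allm v; rewrite v2 negbK /= => vm.
by have /existsPn/(_ a) := mimic_compl W3 pairS v2 vm.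
Qed.

(** Ensures that [2 ^ k] vertices suffice to use every pair from [k.+1] elements as a label. *)
Lemma bin2_leq k : 'C(k.+1, 2) <= 2 ^ k.
Proof.
elim: k => // k IHk; rewrite binS bin1 expnS mul2n -addnn leq_add //.
exact: ltn_expl.
Qed.

Lemma simple_extension_large (G : graph) k :
  2 < k -> 2 ^ k.-1 <= #|G| < 2 ^ k -> simple_extension_by G k.
Proof.
move=> k3 /andP[Gge Glt]; rewrite -[k]card_ord.
have W3 : 2 < #|'I_k| by rewrite card_ord.
have cT : #|{set 'I_k}| = 2 ^ k.
  by rewrite -cardsT -powersetT card_powerset cardsT card_ord.
have pairsG : #|[set A : {set 'I_k} | #|A| == 2]| <= #|G|.
  rewrite card_draws card_ord (leq_trans _ Gge) // -{1}(ltn_predK k3).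
  exact: bin2_leq.
(* With [2 ^ k - 1] vertices, avoiding [setT] forces all other labels, including [set0]; with fewer,
   both can be avoided. *)
have [full|notfull] := eqVneq #|G| (2 ^ k).-1.
  have cQ : #|[set~ [set: 'I_k]]| = #|G| by rewrite cardsC1 cT full.
  have [||S [injS surjS ST]] := @inj_between G _ [set~ [set: 'I_k]] [set~ [set: 'I_k]].
  - exact: subxx.
  - by rewrite cQ leqnn.
  have {}ST v : S v != setT by have := ST v; rewrite !inE.
  have {}surjS A : A != setT -> exists v, S v = A.
    by move=> AT; apply: surjS; rewrite !inE.
  have [nb|nb] := boolP [forall v : G, [exists x, adj v x]].
    exact (simple_extension_no_isolated W3 injS ST surjS nb).
  apply: simple_extension_compl.
  apply: (@simple_extension_no_isolated (compl_graph G) _ S) => //.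
  apply: compl_no_isolated nb.
  by rewrite (leq_trans _ Gge) // -{1}(expn0 2) ltn_exp2l // -ltnS (ltn_predK k3) ltnW.
pose Q := ~: [set set0; [set: 'I_k]].
have [||S [injS pairS SQ]] := @inj_between G _ [set A : {set 'I_k} | #|A| == 2] Q.
- apply/subsetP => A; rewrite !inE negb_or => /eqP A2; apply/andP; split.
    by rewrite -cards_eq0 A2.
  by apply: contraTneq W3 => AT; rewrite -cardsT -AT A2.
- rewrite pairsG cardsCs setCK cT cards2.
  have -> : set0 != [set: 'I_k].
    by rewrite eq_sym -cards_eq0 cardsT -lt0n (leq_trans _ W3).
  move: Glt notfull; case: (2 ^ k) => // m; rewrite ltnS leq_eqVlt => /orP[/eqP->|].
    by rewrite eqxx.
  by rewrite subSS subn1; case: m.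
apply: (@simple_extension_no_empty_label G _ S) => // [v|v|A A2].
- by have := SQ v; rewrite !inE negb_or => /andP[].
- by have := SQ v; rewrite !inE negb_or => /andP[].
- by apply: pairS; rewrite inE A2.
Qed.

(** * Graphs with at most three vertices *)

Lemma simple_extension_center (G : graph) (c x y : G) :
  (forall v, v \in [:: c; x; y]) -> uniq [:: c; x; y] ->
  adj c x -> adj c y -> simple_extension_by G 2.
Proof.
move=> covG /=; rewrite !inE negb_or andbT => /andP[/andP[cx cy] xy] acx acy.
(* With two new vertices the only pair is [setT]. Instead [x] and [y] each get a private new vertex,
   and [c] gets the empty label. *)
pose S v := [set b : bool | (v == if b then x else y)].
have SE v b : (b \in S v) = (v == if b then x else y) by rewrite inE.
have covP v : [\/ v = c, v = x | v = y].
  by have := covG v; rewrite !inE => /or3P[] /eqP; [constructor 1|constructor 2|constructor 3].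
have neq := (negPf cx, negPf cy, negPf xy).
have neq' := (eq_sym x c, eq_sym y c, eq_sym y x, neq, eqxx).
exists (ext_graph S); split; first exact: ext_graph_contains.
  apply: ext_graph_simple; first by rewrite card_bool.
  - move=> u v /setP Suv; have := Suv true; have := Suv false; rewrite !SE.
    by case: (covP u) => ->; case: (covP v) => ->; rewrite ?neq'.
  - move=> v; apply/eqP => /setP Sv; have := Sv true; have := Sv false.
    by rewrite !SE !inE /= => /eqP->; rewrite !neq'.
  - move=> v /setP Sv; have := Sv true; have := Sv false; rewrite !SE !inE.
    by case: (covP v) => ->; rewrite ?neq' //; exists x.
  move=> I a b /intervalP iI aI bI.
  have ba : b = ~~ a by case: a b aI bI => -[] // ->.
  pose xa := if a then x else y; pose xb := if b then x else y.
  (* If [c] is in [I], then [xb] is not, as [b] sees it but not [a]; but [c] sees [xb] and [a] does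
     not. *)
  have cI : inl c \notin I.
    apply/negP => cI; have xbI : inl xb \notin I.
      apply/negP => xbI; have := iI _ _ aI xbI (inr b) bI.
      by rewrite /= SE eqxx.
    have := iI _ _ aI cI (inl xb) xbI.
    by rewrite /= SE /xb ba; case: (a) => /=; rewrite ?neq' ?acx ?acy.
  apply/setP => -[v|d]; rewrite !inE; last first.
    apply/idP/eqP => [dI|[->//]]; congr inr; apply/eqP; apply: contraTT dI => da.
    by have -> : d = b by rewrite ba; case: (d) (a) da => -[].
  apply/negbTE/negP => vI.
  have av : adj c v.
    by case: (covP v) vI => -> // vI; case/negP: cI.
  have := iI _ _ aI vI (inl c) cI.
  by rewrite /= SE adj_sym av; case: (a); rewrite neq'.
by rewrite card_sum card_bool.
Qed.

(** Two of the three vertex pairs are both edges or both non-edges, and they share a vertex, which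
    is the center in [G] or in its complement. *)
Lemma simple_extension_card3 (G : graph) : #|G| = 3 -> simple_extension_by G 2.
Proof.
move=> G3.
have [x [y [z [covG uniqG]]]] : exists x y z : G,
    (forall v, v \in [:: x; y; z]) /\ uniq [:: x; y; z].
  move: (enum_uniq G) (mem_enum G) (cardE G); rewrite G3.
  case: (enum G) => [|x [|y [|z []]]] // us mems _.
  by exists x, y, z; split=> // v; rewrite mems.
have covG2 v : v \in [:: y; x; z] by have := covG v; rewrite !inE orbCA.
have covG3 v : v \in [:: z; x; y].
  by have := covG v; rewrite !inE orbA orbC.
have uniqG2 : uniq [:: y; x; z].
  by rewrite (perm_uniq (s2 := [:: x; y; z])) // (perm_catCA [:: y] [:: x] [:: z]).
have uniqG3 : uniq [:: z; x; y].
  by rewrite (perm_uniq (s2 := [:: x; y; z])) // (perm_catC [:: z] [:: x; y]).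
have center c u v : (forall w : G, w \in [:: c; u; v]) -> uniq [:: c; u; v] ->
    adj c u = adj c v -> simple_extension_by G 2.
  move=> cov un cuv; have [cv|cv] := boolP (adj c v).
    by apply: (simple_extension_center cov un _ cv); rewrite cuv.
  apply: simple_extension_compl.
  apply: (@simple_extension_center (compl_graph G) c u v) => //=;
    move: un; rewrite /= !inE negb_or /co_adj ?cuv cv => /andP[/andP[cu ncv] _];
    by rewrite ?cu ?ncv.
have := center _ _ _ covG uniqG; have := center _ _ _ covG2 uniqG2.
have := center _ _ _ covG3 uniqG3; rewrite (adj_sym y x) (adj_sym z x) (adj_sym z y).
by case: (adj x y); case: (adj x z); case: (adj y z) => c3 c2 c1;
   by [apply: c1 | apply: c2 | apply: c3].
Qed.

Lemma simple_graph_card2 (G : graph) : #|G| <= 2 -> simple_graph G.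
Proof.
move=> G2; apply: simple_graphI => I _.
have := subset_leq_card (subsetT I); rewrite cardsT => IG.
have [I0|I0] := posnP #|I|; first by constructor 1; apply/eqP; rewrite -cards_eq0 I0.
have [/eqP/cards1P[u ->]|I1] := eqVneq #|I| 1; first by constructor 2; exists u.
constructor 3; apply/eqP; rewrite eqEcard subsetT cardsT (leq_trans G2) //.
by rewrite ltn_neqAle eq_sym I1.
Qed.

(* up_log 2 m is the least e with m <= 2 ^ e, that is, the ceiling of the
   base 2 logarithm of m for m >= 1.  The natural number subtraction is not
   truncated, since an induced embedding is injective. *)
Theorem theorem3p1 (G : graph) (hG : 1 <= #|G|) :
  exists G' : graph,
    [/\ contains_induced G' G,
        simple_graph G' &
        #|G'| - #|G| <= up_log 2 #|G|.+1].
Proof.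
have [G2|G3] := leqP #|G| 2.
  exists G; split; last by rewrite subnn.
    by exists id; split=> // u v.
  exact: simple_graph_card2.
suff [G' [cG' sG' eG']] : simple_extension_by G (up_log 2 #|G|.+1).
  by exists G'; split; rewrite // eG' addKn.
have [G3'|Gn3] := eqVneq #|G| 3; first by rewrite G3'; apply: simple_extension_card3.
have /andP[kl ku] := up_log_bounds (isT : 1 < 2) (hG : 1 < #|G|.+1).
apply: simple_extension_large; last by rewrite -ltnS kl.
(* Since [#|G|] exceeds 3 here, the logarithm exceeds 2. *)
rewrite ltnNge; apply/negP => k2.
have : #|G|.+1 <= 2 ^ 2 by rewrite (leq_trans ku) // leq_exp2l.
by rewrite ltnS leqNgt ltn_neqAle eq_sym Gn3 G3.
Qed.
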